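(* Let $G$ be a finite graph and $\mathcal L$ a non-trivial linear class of bonds of $G$. Then the independent sets of the complete join matroid $J_0(G,\mathcal L)$ are exactly: (1) the edge sets of forests of $G$, and (2) the sets $F\cup\{e_0\}$ where $F$ is the edge set of a forest of $G$ and the partition $\pi_F$ is un-cobalanced.
   Context: Graphs are finite, loops and multiple edges allowed. A bond is a minimal nonempty edge cut; $\delta(X)$ is the set of links with exactly one endpoint in $X\subseteq V(G)$. A tribond is $\delta(X_1)\cup\delta(X_2)\cup\delta(X_3)$ for a partition $\{X_1,X_2,X_3\}$ of the vertex set of one connected component into nonempty sets with each $G[X_i]$ connected and an edge joining each pair. A linear class of bonds is a set $\mathcal L$ of bonds such that for each such tripartition the number of $i$ with $\delta(X_i)\in\mathcal L$ is never exactly two; it is trivial if it contains every bond; bonds in $\mathcal L$ are cobalanced. A modular pair of bonds $B_1,B_2$ is one for which $G-(B_1\cup B_2)$ has two more components than $G$; a dibond is the union of a modular pair that is not a tribond. For non-trivial $\mathcal L$, $J_0(G,\mathcal L)$ is the matroid on $E(G)\cup\{e_0\}$ whose cocircuits are the bonds in $\mathcal L$, the sets $B\cup\{e_0\}$ for bonds $B\notin\mathcal L$, and the tribonds and dibonds containing no bond of $\mathcal L$. For $F\subseteq E(G)$, $\pi_F$ is the partition of $V(G)$ into vertex sets of the components of $(V(G),F)$; $\mathrm{Ext}(\pi)$ is the set of edges of $G$ whose endpoints lie in different parts of $\pi$. A partition $\pi$ (with each part inducing a connected subgraph) is cobalanced if every bond of $G$ contained in $\mathrm{Ext}(\pi)$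 lies in $\mathcal L$, and un-cobalanced otherwise. *)

(* Defs.v *)
From HB Require Import structures.
From mathcomp Require Import all_boot all_order.

Set Implicit Arguments.
Unset Strict Implicit.
Unset Printing Implicit Defensive.

Definition matroid_axioms (T : finType) (S : {set {set T}}) : bool :=
  [&& set0 \in S,
      [forall A in S, forall B : {set T}, (B \subset A) ==> (B \in S)]
    & [forall A in S, forall B in S,
        (#|A| < #|B|) ==> [exists x in B :\: A, x |: A \in S]]].

Record matroid (T : finType) := Matroid {
  indep : {set {set T}};
  indepP : matroid_axioms indep }.

HB.instance Definition _ (T : finType) := [isSub for @indep T].
HB.instance Definition _ (T : finType) := [Finite of matroid T by <:].

Lemma trivial_matroid_subproof (T : finType) : @matroid_axioms T [set set0].
Proof.
apply/and3P; split; first by rewrite inE.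
- apply/forall_inP => A; rewrite inE => /eqP ->; apply/forallP => B.
  by rewrite subset0 inE implybb.
- apply/forall_inP => A _; apply/forall_inP => B; rewrite inE => /eqP ->.
  by rewrite cards0 ltn0.
Qed.

Definition trivial_matroid (T : finType) : matroid T :=
  Matroid (trivial_matroid_subproof T).

Section MatroidNotions.
Variables (T : finType) (M : matroid T).

Definition base (B : {set T}) : bool := maxset (fun A => A \in indep M) B.

(* The bases of the dual matroid are the complements of the bases, so these
   are its independent sets, and its circuits are the cocircuits. *)
Definition coindep (A : {set T}) : bool :=
  [exists B : {set T}, base B && (A \subset ~: B)].

Definition cocircuits : {set {set T}} :=
  [set C | minset (fun A => ~~ coindep A) C].

End MatroidNotions.

(* Loops are the edges e with both ends equal; of [ends e] only the underlying
   unordered pair is ever used. *)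
Record multigraph (V E : finType) := Multigraph { ends : E -> V * V }.

Section Graph.
Variables (V E : finType) (G : multigraph V E).
Implicit Types (e : E) (F B D : {set E}) (X Y : {set V}) (L : {set {set E}}).

Definition joins e (u v : V) : bool :=
  (ends G e == (u, v)) || (ends G e == (v, u)).

Definition adjacent F (u v : V) : bool := [exists e in F, joins e u v].

Definition components F : {set {set V}} :=
  equivalence_partition (connect (adjacent F)) [set: V].

(* The cycle v_1 e_1 v_2 e_2 ... v_n e_n v_1 is encoded by the sequence of
   pairs (v_i, e_i); n = 1 is a loop, n = 2 a pair of parallel links. *)
Definition graph_cycle (p : seq (V * E)) : bool :=
  [&& p != [::], uniq (unzip1 p), uniq (unzip2 p)
    & cycle (fun a b => joins a.2 a.1 b.1) p].

Definition forest F : Prop :=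
  forall p, graph_cycle p -> ~ {subset unzip2 p <= F}.

Definition delta X : {set E} :=
  [set e | ((ends G e).1 \in X) != ((ends G e).2 \in X)].

Definition bond B : bool :=
  minset (fun D => (D != set0) && [exists X, D == delta X]) B.

Definition inner_edges X : {set E} :=
  [set e | ((ends G e).1 \in X) && ((ends G e).2 \in X)].

Definition induces_connected X : bool :=
  [forall u in X, forall v in X, connect (adjacent (inner_edges X)) u v].

Definition edge_between X Y : bool :=
  [exists u in X, exists v in Y, adjacent [set: E] u v].

Definition tripartition X1 X2 X3 : bool :=
  [&& [&& X1 != set0, X2 != set0 & X3 != set0],
      [&& [disjoint X1 & X2], [disjoint X1 & X3] & [disjoint X2 & X3]],
      X1 :|: X2 :|: X3 \in components [set: E],
      [&& induces_connected X1, induces_connected X2 & induces_connected X3]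
    & [&& edge_between X1 X2, edge_between X1 X3 & edge_between X2 X3]].

Definition tribond D : bool :=
  [exists X1, exists X2, exists X3,
    tripartition X1 X2 X3 && (D == delta X1 :|: delta X2 :|: delta X3)].

Definition modular_pair B1 B2 : bool :=
  [&& bond B1, bond B2
    & #|components (~: (B1 :|: B2))| == #|components [set: E]| + 2].

Definition dibond D : bool :=
  [exists B1, exists B2, modular_pair B1 B2 && (D == B1 :|: B2)]
    && ~~ tribond D.

Definition linear_class L : Prop :=
  (forall B, B \in L -> bond B) /\
  (forall X1 X2 X3, tripartition X1 X2 X3 ->
     (delta X1 \in L) + (delta X2 \in L) + (delta X3 \in L) <> 2).

Definition trivial_class L : Prop := forall B, bond B -> B \in L.

Definition Ext (P : {set {set V}}) : {set E} :=
  [set e | pblock P (ends G e).1 != pblock P (ends G e).2].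

Definition cobalanced L (P : {set {set V}}) : Prop :=
  forall B, bond B -> B \subset Ext P -> B \in L.

(* E and E + {e_0} : [Some e] is the edge e and [None] is e_0. *)
Definition lift_edges F : {set option E} := Some @: F.
Definition add_e0 F : {set option E} := None |: lift_edges F.

Definition J0_cocircuits L : {set {set option E}} :=
  [set lift_edges B | B in L]
  :|: [set add_e0 B | B : {set E} & bond B && (B \notin L)]
  :|: [set lift_edges D | D : {set E} &
        (tribond D || dibond D) && [forall B in L, ~~ (B \subset D)]].

(* A matroid is determined by its cocircuits, so the choice made by [pick] is
   immaterial; the default is only reached if no matroid has the prescribed
   cocircuits, which is not the case when L is a non-trivial linear class. *)
Definition J0 L : matroid (option E) :=
  odflt (trivial_matroid (option E))
    [pick M : matroid (option E) | cocircuits M == J0_cocircuits L].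

End Graph.

(* Main.v *)
Require Import Defs.
From mathcomp Require Import all_boot all_order.

Set Implicit Arguments.
Unset Strict Implicit.
Unset Printing Implicit Defensive.

(** In the graphic matroid M(G), bonds are the complements of hyperplanes, and
    tribonds and dibonds are exactly the complements of flats of corank two; a
    tribond is the union of any two of its three bonds, so a linear class is a
    linear subclass of hyperplanes and J_0 is Crapo's single-element extension
    of M(G) by e_0, which lies in the closure of F iff every hyperplane
    containing F belongs to the class, i.e. iff pi_F is cobalanced.  The sets
    (1) and (2) therefore form a matroid; exchange reduces to the fact that if
    F is un-cobalanced and F + e, F + f are cobalanced, then f is in the span of
    F + e: otherwise F extends, inside a hyperplane outside the class, to a set
    of corank two over which e and f are still independent, where linearity
    fails.  The cocircuits of this matroid are the prescribed ones, and
    cocircuits determine a matroid. *)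

(** * The graphic matroid: connectivity, span and component count *)

Section GraphicMatroid.
Variables (V E : finType) (G : multigraph V E).
Implicit Types (e f x : E) (F S T B D : {set E}) (X Y : {set V}) (u v w : V).

Definition conn F : rel V := connect (adjacent G F).
Definition span F : {set E} := [set x | conn F (ends G x).1 (ends G x).2].
Definition ncomp F : nat := #|components G F|.

Lemma joins_ends e : joins G e (ends G e).1 (ends G e).2.
Proof. by rewrite /joins -surjective_pairing eqxx. Qed.

Lemma joinsC e u v : joins G e u v = joins G e v u.
Proof. by rewrite /joins orbC. Qed.

Lemma joinsP e u v : joins G e u v ->
  (u = (ends G e).1 /\ v = (ends G e).2) \/ (u = (ends G e).2 /\ v = (ends G e).1).
Proof. by case/orP=> /eqP->; [left | right]. Qed.

Lemma joins_inj e u v u' v' : joins G e u v -> joins G e u' v' ->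
  (u = u' /\ v = v') \/ (u = v' /\ v = u').
Proof.
by move=> /joinsP[] [-> ->] /joinsP[] [-> ->]; [left | right | right | left].
Qed.

Lemma adjacentC F : symmetric (adjacent G F).
Proof.
by move=> u v; apply: eq_existsb => e; rewrite joinsC.
Qed.

Lemma connC F : symmetric (conn F).
Proof. exact: (sym_connect_sym (@adjacentC F)). Qed.

Lemma conn_refl F : reflexive (conn F).
Proof. by move=> u; exact: connect0. Qed.

Lemma conn_trans F : transitive (conn F).
Proof. exact: connect_trans. Qed.

Lemma conn_root F u v :
  conn F u v = (root (adjacent G F) u == root (adjacent G F) v).
Proof. by rewrite root_connect //; apply: connC. Qed.

Lemma joins_conn F e u v : e \in F -> joins G e u v -> conn F u v.
Proof. by move=> eF juv; apply/connect1/exists_inP; exists e. Qed.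

(** Replaces path inductions by labellings: [F] cannot connect vertices with different labels if no
    edge of [F] changes the label. Roots of another edge set and membership in a vertex set serve as
    labels below. *)
Lemma conn_invariant F (T : eqType) (h : V -> T) :
  (forall x, x \in F -> h (ends G x).1 = h (ends G x).2) ->
  forall u v, conn F u v -> h u = h v.
Proof.
move=> hF u v /connectP[p]; elim: p u => [|w p IH] u /=; first by move=> _ ->.
case/andP=> /exists_inP[x xF juw] pp lp; rewrite -(IH w pp lp).
by have [[-> ->]|[-> ->]] := joinsP juw; rewrite hF.
Qed.

Lemma span_joins F e u v : joins G e u v -> (e \in span F) = conn F u v.
Proof. by move=> /joinsP[] [-> ->]; rewrite inE // connC. Qed.

Lemma sub_span F : F \subset span F.
Proof.
by apply/subsetP=> x xF; rewrite inE (joins_conn xF) // joins_ends.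
Qed.

Lemma conn_sub F S : F \subset span S -> subrel (conn F) (conn S).
Proof.
move=> FS u v; rewrite conn_root => uv; rewrite conn_root.
apply/eqP; apply: (@conn_invariant F); last by rewrite conn_root.
by move=> x /(subsetP FS); rewrite inE conn_root => /eqP.
Qed.

Lemma span_sub F S : F \subset span S -> span F \subset span S.
Proof.
by move=> FS; apply/subsetP=> x; rewrite !inE; apply: conn_sub.
Qed.

Lemma spanS F S : F \subset S -> span F \subset span S.
Proof. by move=> FS; apply: span_sub; apply: subset_trans FS (sub_span S). Qed.

(** Adding [e] merges the component of [b] into that of [a], so redirecting the root of [b] to that
    of [a] gives a labelling whose fibres are the new components. This kernel form is what
    [ncomp_image] counts. *)
Lemma conn_add_root F e a b u v (r := root (adjacent G F)) : joins G e a b ->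
  conn (e |: F) u v =
    ((if r u == r b then r a else r u) == (if r v == r b then r a else r v)).
Proof.
move=> jab; pose m w := if r w == r b then r a else r w.
have sF : subrel (conn F) (conn (e |: F)).
  by apply: conn_sub; apply: subset_trans (sub_span _); apply: subsetUr.
have cm w : conn (e |: F) w (m w).
  rewrite /m; case: eqP => [/eqP|_]; last exact/sF/connect_root.
  rewrite -conn_root => /sF wb; apply: conn_trans wb _; rewrite connC.
  apply: (@conn_trans _ a); last by rewrite (joins_conn _ jab) ?setU11.
  by rewrite connC; apply/sF/connect_root.
apply/idP/eqP => [|muv].
  apply: (@conn_invariant _ _ m) => x; rewrite /m => /setU1P[->|xF].
    by have [[<- <-]|[<- <-]] := joinsP jab; rewrite eqxx; case: eqP.
  by have := joins_conn xF (joins_ends x); rewrite conn_root -/r => /eqP ->.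
by apply: conn_trans (cm u) _; rewrite connC [m u]muv.
Qed.

Lemma conn_add F e a b u v : joins G e a b ->
  conn (e |: F) u v =
    [|| conn F u v, conn F u a && conn F b v | conn F u b && conn F a v].
Proof.
move=> jab; rewrite (conn_add_root _ _ _ jab) !conn_root; set r := root _.
move: (r u) (r v) (r a) (r b) => x y p q.
case: (eqVneq x q) => [->|nx]; case: (eqVneq y q) => [->|ny].
- by rewrite eqxx.
- by rewrite andbF.
- by rewrite (negPf nx) andbT orbF.
- by rewrite andbF orbF.
Qed.

Lemma ncomp_image (T : finType) (h : V -> T) F :
  (forall u v, conn F u v = (h u == h v)) -> ncomp F = #|h @: [set: V]|.
Proof.
move=> hF; rewrite /ncomp /components /equivalence_partition.
have -> : [set [set y in [set: V] | connect (adjacent G F) x y] | x in [set: V]]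
   = (fun t => [set y | t == h y]) @: (h @: [set: V]).
  rewrite -imset_comp; apply: eq_imset => x; apply/setP=> y.
  by rewrite !inE -[connect _ x y]/(conn F x y) hF.
apply: card_in_imset => _ _ /imsetP[x _ ->] /imsetP[y _ ->] /setP/(_ x).
by rewrite !inE eqxx => /esym/eqP.
Qed.

Lemma ncomp_root F : ncomp F = #|root (adjacent G F) @: [set: V]|.
Proof. by apply: ncomp_image => u v; apply: conn_root. Qed.

Lemma ncomp_sub F S : F \subset span S -> ncomp S <= ncomp F.
Proof.
move=> FS; rewrite (ncomp_root S) (ncomp_root F).
have -> : root (adjacent G S) @: [set: V]
    = root (adjacent G S) @: (root (adjacent G F) @: [set: V]).
  rewrite -imset_comp; apply: eq_imset => x /=; apply/eqP.
  rewrite -conn_root; apply: (conn_sub FS); exact: connect_root.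
exact: leq_imset_card.
Qed.

Lemma ncomp_span F : ncomp (span F) = ncomp F.
Proof.
by apply/eqP; rewrite eqn_leq !ncomp_sub // (subset_trans (sub_span _) (sub_span _)).
Qed.

(** The relabelling of [conn_add_root] takes as values all the old roots except that of [b]. *)
Lemma ncomp_add F e : e \notin span F -> ncomp F = (ncomp (e |: F)).+1.
Proof.
move=> ne; have [a [b jab]] : exists a b, joins G e a b.
  by exists (ends G e).1, (ends G e).2; apply: joins_ends.
move: ne; rewrite (span_joins _ jab) conn_root; set r := root _ => nab.
have H u v := conn_add_root F u v jab.
rewrite (ncomp_image H) ncomp_root -/r.
rewrite (cardsD1 (r b) (r @: _)) imset_f // add1n; congr _.+1; congr #|pred_of_set _|.
apply/setP=> t; rewrite !inE; apply/andP/imsetP.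
  by move=> [ntb /imsetP[x _ tx]]; exists x => //; rewrite -tx (negPf ntb).
move=> [x _ ->]; case: ifP => [_|nx]; first by rewrite nab imset_f.
by rewrite nx imset_f.
Qed.

(** An edge of [S] outside [span F] could be added to [F] without leaving [span S], bringing the
    count below [ncomp S]. *)
Lemma span_eq F S : F \subset span S -> ncomp F = ncomp S -> span F = span S.
Proof.
move=> FS nFS; apply/eqP; rewrite eqEsubset span_sub //; apply/span_sub/subsetP=> e eS.
apply: contraT => /ncomp_add; rewrite nFS => H.
have : ncomp S <= ncomp (e |: F); last by rewrite H ltnn.
by apply: ncomp_sub; rewrite subUset FS sub1set (subsetP (sub_span S)).
Qed.

Lemma span_full_ncomp F : span F = setT <-> ncomp F = ncomp setT.
Proof.
split=> [FT|/span_eq->]; first by rewrite -ncomp_span FT.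
  by apply/eqP; rewrite -subTset sub_span.
exact: subset_trans (subsetT _) (sub_span _).
Qed.

Lemma ncomp_ge F : ncomp setT <= ncomp F.
Proof. by apply: ncomp_sub; apply: subset_trans (subsetT _) (sub_span _). Qed.

(** Both [e |: F] and [f |: F] have one component less than [F], and the second lies in the span of
    the first, so [span_eq] makes the spans equal. *)
Lemma span_exchange F e f :
  f \in span (e |: F) -> f \notin span F -> e \in span (f |: F).
Proof.
move=> fe nf; have nef : e \notin span F.
  apply: contra nf => eF; apply: subsetP fe; apply: span_sub.
  by rewrite subUset sub1set eF sub_span.
have H : f |: F \subset span (e |: F).
  by rewrite subUset sub1set fe (subset_trans (subsetUr _ _) (sub_span _)).
rewrite (span_eq H); last by apply: succn_inj; rewrite -!ncomp_add.
by rewrite (subsetP (sub_span _)) ?setU11.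
Qed.

(** Adding an edge outside the span lowers the count by exactly one, so every intermediate value is
    attained. It is used to produce supersets of corank one or two. *)
Lemma ncomp_extend F k : ncomp setT <= k <= ncomp F ->
  exists2 S : {set E}, F \subset S & ncomp S = k.
Proof.
case/andP=> ck kF; have [n] := ubnP (ncomp F - k); elim: n F kF => // n IH F kF.
rewrite ltnS => le_n; case: (eqVneq (ncomp F) k) => [<-|nk]; first by exists F.
have [e ne] : exists e, e \notin span F.
  apply/existsP; rewrite -negb_forall; apply: contra nk => /forallP H.
  have /span_full_ncomp H1 : span F = setT by apply/setP=> x; rewrite H inE.
  by rewrite eqn_leq kF H1 ck.
have := ncomp_add ne => nF; have lt : k < ncomp F by rewrite ltn_neqAle eq_sym nk.
have [||S sS nS] := IH (e |: F); first by rewrite -ltnS -nF.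
  by rewrite -ltnS -subSn -?nF // -ltnS -nF.
by exists S => //; apply: subset_trans sS; apply: subsetUr.
Qed.

(** * Cycles, and forests as independent sets *)

Lemma cycle_conn F (p : seq (V * E)) (y z : V * E) :
  path (fun a b => joins G a.2 a.1 b.1) y (rcons p z) ->
  {subset unzip2 (y :: p) <= F} -> conn F y.1 z.1.
Proof.
elim: p y => [|w p IH] y /=; rewrite ?andbT.
  by move=> j sF; apply: joins_conn j; apply: sF; rewrite inE.
case/andP=> j /IH{}IH sF; apply: conn_trans (IH _).
  by apply: joins_conn j; apply: sF; rewrite inE eqxx.
by move=> x xp; apply: sF; rewrite inE xp orbT.
Qed.

Lemma forest_sub F S : F \subset S -> forest G S -> forest G F.
Proof. by move=> /subsetP FS fS p cp pF; apply: (fS p cp) => x /pF/FS. Qed.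

(** A cycle through [e], rotated to start there, leaves a path in [F] between the ends of [e]. *)
Lemma forest_add F e : forest G F -> e \notin span F -> forest G (e |: F).
Proof.
move=> fF ne p cp pF; case: (boolP (e \in unzip2 p)) => [/mapP[[v e'] /= vp E']|np].
  move: vp; rewrite -{}E' => vp; move/negP: ne; apply.
  have [i q def] := rot_to vp; case/and4P: cp => _ _.
  have -> : uniq (unzip2 p) = uniq (unzip2 (rot i p)).
    by rewrite /unzip2 map_rot rot_uniq.
  rewrite -(rot_cycle i) def => /= /andP[eq _] cyc.
  have sq : {subset unzip2 q <= F}.
    move=> x xq; have: x \in unzip2 p.
      by rewrite /unzip2 -(mem_rot i) -map_rot def inE xq orbT.
    by case/pF/setU1P=> // xe; move: xq eq; rewrite xe => ->.
  (* An empty remainder means that [e] is a loop, and a loop lies in every span. *)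
  case: q {def eq} sq cyc => [|w q] sq /=.
    by rewrite andbT => /(span_joins F)->; apply: conn_refl.
  case/andP=> j pq; rewrite (span_joins _ j) connC.
  exact: (cycle_conn pq).
by apply: (fF p cp) => x xp; case/setU1P: (pF x xp) => // xe; rewrite -xe xp in np.
Qed.

(* The last clause lets the path be closed into a [graph_cycle]: take
   [y = z = (last u s, e)] with [e] an edge from [last u s] back to [u]. *)
Lemma simple_path_edges F u s : path (adjacent G F) u s -> uniq (u :: s) ->
  exists q : seq (V * E),
    [/\ unzip1 q = belast u s, {subset unzip2 q <= F}, uniq (unzip2 q),
        forall x, x \in unzip2 q ->
          exists v w, [/\ v \in u :: s, w \in u :: s & joins G x v w]
      & forall y z : V * E, joins G y.2 y.1 u -> z.1 = last u s ->
          path (fun a b => joins G a.2 a.1 b.1) y (rcons q z)].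
Proof.
elim: s u => [|w s IH] u.
  by move=> _ _; exists [::]; split=> //= y z j ->; rewrite j.
rewrite /= => /andP[/exists_inP[x xF jx] /IH{}IH] /andP[us /IH[q [q1 qF uq jq pq]]].
exists ((u, x) :: q); split=> /=; first by rewrite q1.
- by move=> y /predU1P[->//|/qF].
- rewrite uq andbT; apply/negP=> /jq[v [v' [vs v's jv]]].
  by case: (joins_inj jx jv) => [] [uv _]; rewrite uv ?vs ?v's in us.
- move=> y /predU1P[->|/jq[v [v' [vs v's jv]]]].
    by exists u, w; rewrite !inE !eqxx orbT.
  by exists v, v'; rewrite !(in_cons u) vs v's !orbT.
- by move=> y z j zl; rewrite j pq.
Qed.

(** If [F] connected the ends of [e], a simple path of [F] closed by [e] would be a cycle. *)
Lemma forest_notin_span F e : e \notin F -> forest G (e |: F) -> e \notin span F.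
Proof.
move=> eF fF; apply/negP; rewrite (span_joins F (joins_ends e)).
case/connectP=> p0 pp0 lp0; case: (shortenP pp0) lp0 => p pp up _ lp {p0 pp0}.
have [q [q1 qF uq _ pq]] := simple_path_edges pp up.
apply: (fF (((ends G e).2, e) :: q)).
  apply/and4P; split=> //=; last by apply: pq; rewrite //= joinsC joins_ends.
    by move: up; rewrite q1 lp lastI rcons_uniq.
  by rewrite uq andbT; apply: contra eF; apply: qF.
by move=> x; rewrite !inE => /predU1P[->|/qF->]; rewrite ?eqxx ?orbT.
Qed.

Lemma forest0 : forest G set0.
Proof.
move=> [|x p]; first by [].
by move=> _ /(_ x.2); rewrite !inE eqxx => /(_ isT).
Qed.

Lemma ncomp0 : ncomp set0 = #|V|.
Proof.
rewrite (@ncomp_image _ id) ?imset_id ?cardsT // => u v.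
apply/idP/eqP => [|->]; last exact: conn_refl.
by apply: (@conn_invariant _ _ id) => x; rewrite inE.
Qed.

Lemma ncomp_card F : #|V| <= ncomp F + #|F|.
Proof.
have [n] := ubnP #|F|; elim: n F => // n IH F; rewrite ltnS => Fn.
case: (set_0Vmem F) => [->|[e eF]]; first by rewrite ncomp0 leq_addr.
have cF := cardsD1 e F; rewrite eF in cF.
have := IH (F :\ e); rewrite cF in Fn => /(_ Fn) /leq_trans-> //.
rewrite cF addnA leq_add2r addn1.
case: (boolP (e \in span (F :\ e))) => [es|/ncomp_add]; last by rewrite setD1K // => ->.
apply: leqW; apply: ncomp_sub.
rewrite -[X in pred_of_set X \subset _](setD1K eF) subUset sub1set es.
exact: sub_span.
Qed.

(** Induction on the number of edges. Dropping an edge that lies in the span of the others keeps the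
    count, so the equation fails by [ncomp_card], and there is a cycle; dropping any other edge
    raises the count by one. Being a forest thus becomes a decidable statement about rank. *)
Lemma forestP F : reflect (forest G F) (ncomp F + #|F| == #|V|).
Proof.
have [n] := ubnP #|F|; elim: n F => // n IH F; rewrite ltnS => Fn.
case: (set_0Vmem F) => [->|[e eF]].
  by rewrite ncomp0 cards0 addn0 eqxx; constructor; apply: forest0.
have cF := cardsD1 e F; rewrite eF add1n in cF; rewrite cF in Fn *.
have nD : e \notin F :\ e by rewrite !inE eqxx.
case: (boolP (e \in span (F :\ e))) => es.
  have -> : ncomp F = ncomp (F :\ e).
    apply/eqP; rewrite eqn_leq !ncomp_sub //.
      by rewrite -[X in pred_of_set X \subset _](setD1K eF) subUset sub1set es sub_span.
    exact: subset_trans (subD1set _ _) (sub_span _).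
  have -> : (ncomp (F :\ e) + #|F :\ e|.+1 == #|V|) = false.
    by apply/negbTE; rewrite addnS neq_ltn ltnS ncomp_card orbT.
  constructor => fF; move: es; apply/negP/forest_notin_span => //.
  by rewrite setD1K.
have := ncomp_add es; rewrite setD1K // addnS -addSn => <-.
apply: (iffP (IH _ Fn)) => [fD|]; last exact/forest_sub/subD1set.
by rewrite -(setD1K eF); apply: forest_add.
Qed.

Lemma forest_card F : forest G F -> ncomp F + #|F| = #|V|.
Proof. by move/forestP/eqP. Qed.

Lemma ncomp_lt F S : ncomp S < ncomp F ->
  exists2 e, e \in S & e \notin span F.
Proof.
move=> lt; apply/exists_inP; apply: contraLR lt.
rewrite negb_exists_in -leqNgt => /forall_inP H; apply: ncomp_sub.
by apply/subsetP=> x /H/negPn.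
Qed.

(** A forest that is maximal within [S] spans [S], as any edge of [S] outside its span could be
    added. *)
Lemma forest_extend F S : forest G F -> F \subset S ->
  exists T : {set E}, [/\ forest G T, F \subset T, T \subset S & span T = span S].
Proof.
move=> /forestP fF FS.
have [T mT FT] := maxset_exists
  (P := fun T => (ncomp T + #|T| == #|V|) && (T \subset S)) (introT andP (conj fF FS)).
have /maxsetP[/andP[fT TS] mx] := mT.
exists T; split=> //; first exact/forestP.
apply/eqP; rewrite eqEsubset spanS //; apply/span_sub/subsetP=> e eS.
apply: contraT => ne; have fe : forest G (e |: T).
  by apply: forest_add ne; apply/forestP.
have eT : e \in T.
  rewrite -(mx (e |: T)) ?setU11 ?subsetUr // subUset sub1set eS TS !andbT.
  exact/forestP.
by rewrite (subsetP (sub_span T)) in ne.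
Qed.
End GraphicMatroid.

(** * Cuts, bonds as complements of hyperplanes, and flats of corank two *)

Section Cuts.
Variables (V E : finType) (G : multigraph V E).
Implicit Types (e f x : E) (F S T B D : {set E}) (X Y : {set V}) (u v w : V).
Local Notation conn := (conn G).
Local Notation span := (span G).
Local Notation ncomp := (ncomp G).
Local Notation delta := (delta G).

Definition cut D := [exists X, D == delta X].

Lemma cut_delta X : cut (delta X).
Proof. by apply/existsP; exists X. Qed.

Lemma delta_conn F X u v :
  F \subset ~: delta X -> conn F u v -> (u \in X) = (v \in X).
Proof.
move=> FX; apply: (@conn_invariant _ _ G F _ (fun w => w \in X)) => x /(subsetP FX).
by rewrite !inE negbK => /eqP.
Qed.

Lemma cut_span F D : cut D -> F \subset ~: D -> span F \subset ~: D.
Proof.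
move=> /existsP[X /eqP->] FX; apply/subsetP=> x; rewrite !inE negbK.
by move=> /(delta_conn FX) ->.
Qed.

Lemma cutD B D : cut B -> cut D -> cut [set x | (x \in B) (+) (x \in D)].
Proof.
move=> /existsP[X /eqP->] /existsP[Y /eqP->].
apply/existsP; exists [set v | (v \in X) (+) (v \in Y)]; apply/eqP/setP=> x.
by rewrite !inE; do 4!case: (_ \in _).
Qed.

(** The symmetric difference is a cut that avoids [F]. The complement of a cut is a flat, so it
    contains [span F], that is, every edge. *)
Lemma cut_eq F B D : cut B -> cut D -> span F = setT -> {in F, B =i D} -> B = D.
Proof.
move=> cB cD FT eBD; apply/setP=> x; have := cut_span (F := F) (cutD cB cD).
rewrite FT => H.
have {H}/H/subsetP/(_ x) : F \subset ~: [set x | (x \in B) (+) (x \in D)].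
  by apply/subsetP=> y /eBD; rewrite !inE => ->; rewrite addbb.
by rewrite !inE => /(_ isT); case: (x \in B); case: (x \in D).
Qed.

Lemma cut0 : cut set0.
Proof.
by apply/existsP; exists set0; apply/eqP/setP=> x; rewrite !inE.
Qed.

Lemma cut_meets F D : cut D -> D != set0 -> span F = setT -> ~~ (F \subset ~: D).
Proof.
move=> cD nD FT; apply: contra nD => FD; apply/eqP.
by apply: (cut_eq cD cut0 FT) => x /(subsetP FD); rewrite !inE => /negPf.
Qed.

Lemma bondP B : reflect
  [/\ B != set0, cut B & forall D, cut D -> D != set0 -> D \subset B -> D = B]
  (bond G B).
Proof.
apply: (iffP minsetP) => [[/andP[nB cB] mB]|[nB cB mB]].
  by split=> // D cD nD; apply: mB; rewrite nD.
by split=> [|D /andP[nD cD]]; [rewrite nB | apply: mB].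
Qed.

Lemma not_spanning F : ncomp setT < ncomp F -> exists e, e \notin span F.
Proof. by case/ncomp_lt=> e _ ne; exists e. Qed.

Section Hyperplane.
Variable F : {set E}.
Hypothesis hypF : ncomp F = (ncomp setT).+1.

Lemma hyper_add e : e \notin span F -> span (e |: F) = setT.
Proof.
move=> ne; apply/span_full_ncomp; apply: succn_inj.
by rewrite -ncomp_add.
Qed.

(** The vertex set is the component of [a] in [F], for an edge [e] from [a] to [b] outside the span.
    As [e |: F] spans, every edge outside [span F] joins the components of [a] and [b]. *)
Lemma hyper_cut : cut (~: span F).
Proof.
have [|e ne] := @not_spanning F; first by rewrite hypF.
have je := joins_ends G e; have FT := hyper_add ne.
move: ne; rewrite (span_joins _ je); move: je; move: (ends G e) => [a b] /= je nab.
apply/existsP; exists [set y | conn F a y]; apply/eqP/setP=> x.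
rewrite !inE; set u := (ends G x).1; set v := (ends G x).2.
case: (boolP (conn F u v)) => [uv|nuv].
  suff -> : conn F a u = conn F a v by rewrite eqxx.
  by apply/idP/idP => /conn_trans; apply; rewrite // connC.
have : x \in span (e |: F) by rewrite FT inE.
rewrite (span_joins _ (joins_ends G x)) (conn_add _ _ _ je) (negPf nuv) /=.
case/orP=> /andP[c1 c2].
  have -> : conn F a u by rewrite connC.
  suff -> : conn F a v = false by [].
  by apply: contraNF nab => av; apply: conn_trans av _; rewrite connC.
have -> : conn F a v by [].
suff -> : conn F a u = false by [].
by apply: contraNF nab => au; apply: conn_trans au c1.
Qed.

Lemma hyper_unique D : cut D -> D != set0 -> F \subset ~: D -> D = ~: span F.
Proof.
move=> cD nD FD; have [|e ne] := @not_spanning F; first by rewrite hypF.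
apply: (cut_eq cD hyper_cut (hyper_add ne)) => x /setU1P[->|xF].
  rewrite [RHS]inE ne; apply: contraT => eD.
  have := cut_meets cD nD (hyper_add ne); rewrite subUset FD sub1set inE eD //.
have /subsetP/(_ x xF) := FD; rewrite !inE => /negPf->.
by have := subsetP (sub_span G F) x xF; rewrite inE => ->.
Qed.

Lemma hyper_bond : bond G (~: span F).
Proof.
apply/bondP; split; last 1 first.
- move=> D cD nD DF; apply: hyper_unique => //.
  by rewrite subsetC in DF; apply: subset_trans (sub_span _ _) DF.
- have [|e ne] := @not_spanning F; first by rewrite hypF.
  by apply/set0Pn; exists e; rewrite inE.
exact: hyper_cut.
Qed.
End Hyperplane.

(** Extend [~: B] to a set of corank one: the complement of its span is a nonempty cut inside [B],
    hence equals [B] by minimality. *)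
Lemma bond_hyper B : bond G B -> ncomp (~: B) = (ncomp setT).+1.
Proof.
case/bondP=> nB cB mB.
have sB : span (~: B) = ~: B by apply/eqP; rewrite eqEsubset sub_span cut_span.
have lt : ncomp setT < ncomp (~: B).
  rewrite ltn_neqAle ncomp_ge andbT eq_sym; apply: contra nB => /eqP/span_full_ncomp.
  by rewrite sB => /(congr1 (@setC _)); rewrite setCK setCT => ->.
have [|T BT nT] := @ncomp_extend _ _ G (~: B) (ncomp setT).+1; first by rewrite leqnSn.
have [nD cD _] := bondP _ (hyper_bond nT).
have DB : ~: span T = B.
  by apply: mB => //; rewrite subCset (subset_trans BT) ?sub_span.
by rewrite -DB setCK ncomp_span.
Qed.

Lemma bond_span B : bond G B -> span (~: B) = ~: B.
Proof.
by case/bondP=> _ cB _; apply/eqP; rewrite eqEsubset sub_span cut_span.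
Qed.

Lemma corank2_hyper S e : ncomp S = (ncomp setT).+2 -> e \notin span S ->
  ncomp (e |: S) = (ncomp setT).+1.
Proof. by move=> nS /ncomp_add; rewrite nS => -[]. Qed.

Lemma corank2_witness S : ncomp S = (ncomp setT).+2 ->
  exists e f, e \notin span S /\ f \notin span (e |: S).
Proof.
move=> nS; have [|e ne] := @not_spanning S; first by rewrite nS leqW.
by have [|f nf] := @not_spanning (e |: S); [rewrite (corank2_hyper nS ne)|exists e, f].
Qed.

Lemma notin_span_swap S e f : e \notin span S -> f \notin span (e |: S) ->
  f \notin span S /\ e \notin span (f |: S).
Proof.
move=> ne nf; have nfS : f \notin span S.
  by apply: contra nf; apply/subsetP/spanS/subsetUr.
by split=> //; apply: contra nf => /span_exchange; apply.
Qed.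

(** The intersection contains [S] and is strictly smaller than the hyperplane [span (e |: S)], since
    the two hyperplanes differ; hence it has the rank of [S]. *)
Lemma corank2_setI S e f : ncomp S = (ncomp setT).+2 -> e \notin span S ->
  f \notin span (e |: S) -> span (e |: S) :&: span (f |: S) = span S.
Proof.
move=> nS ne nf; have [nfS nef] := notin_span_swap ne nf.
set T := _ :&: _; have ST : S \subset T.
  by rewrite subsetI !(subset_trans (subsetUr _ S) (sub_span _ _)).
have nTe := corank2_hyper nS ne; have nTf := corank2_hyper nS nfS.
have nT : ncomp T = ncomp S.
  apply/eqP; rewrite eqn_leq ncomp_sub /=; last exact: subset_trans ST (sub_span _ _).
  rewrite nS -nTe ltn_neqAle ncomp_sub ?subsetIl // andbT eq_sym; apply/eqP=> nTT.
  have e1 : span T = span (e |: S) by apply: span_eq => //; apply: subsetIl.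
  have e2 : span T = span (f |: S).
    by apply: span_eq; [apply: subsetIr | rewrite nTT nTf].
  by move: nf; rewrite -e1 e2 (subsetP (sub_span _ _)) // setU11.
apply/eqP; rewrite eqEsubset; apply/andP; split.
  rewrite (@span_eq _ _ G S T) ?nT //; first exact: sub_span.
  exact: subset_trans ST (sub_span _ _).
by rewrite subsetI !spanS // subsetUr.
Qed.

(* [D] is the complement of a flat of corank two of the graphic matroid. *)
Definition coline D :=
  exists2 S : {set E}, ncomp S = (ncomp setT).+2 & D = ~: span S.

Lemma coline_hypers D : coline D -> exists S e f,
  [/\ ncomp S = (ncomp setT).+2, e \notin span S, f \notin span (e |: S)
    & D = ~: span (e |: S) :|: ~: span (f |: S)].
Proof.
case=> S nS ->; have [e [f [ne nf]]] := corank2_witness nS.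
by exists S, e, f; split=> //; rewrite -setCI corank2_setI.
Qed.

(** The component count in [modular_pair] says that the corank is two; the complement of the union
    is closed as an intersection of two hyperplanes. *)
Lemma modular_pair_coline B1 B2 : modular_pair G B1 B2 -> coline (B1 :|: B2).
Proof.
case/and3P=> b1 b2; rewrite addn2 => /eqP n12; exists (~: (B1 :|: B2)) => //.
rewrite setCU; apply: (can_inj setCK); rewrite setCK setCU; apply/eqP.
rewrite eqEsubset sub_span subsetI.
apply/and3P; split=> //.
  by apply: subset_trans (spanS G (subsetIl _ _)) _; rewrite bond_span.
by apply: subset_trans (spanS G (subsetIr _ _)) _; rewrite bond_span.
Qed.

Lemma induces_conn F X u v : induces_connected G X -> inner_edges G X \subset F ->
  u \in X -> v \in X -> conn F u v.
Proof.
move=> /forall_inP H XF uX vX; have /forall_inP/(_ v vX) := H u uX.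
by apply: conn_sub; apply: subset_trans XF (sub_span _ _).
Qed.

Lemma edge_betweenP X Y : reflect
  (exists x u v, [/\ u \in X, v \in Y & joins G x u v]) (edge_between G X Y).
Proof.
apply: (iffP exists_inP) => [[u uX /exists_inP[v vY /exists_inP[x _ j]]]|].
  by exists x, u, v.
move=> [x [u [v [uX vY j]]]]; exists u => //; apply/exists_inP; exists v => //.
by apply/exists_inP; exists x.
Qed.

Lemma delta_joins X x u v : joins G x u v -> (x \in delta X) = ((u \in X) != (v \in X)).
Proof. by move=> /joinsP[] [-> ->]; rewrite inE // eq_sym. Qed.

Lemma component_conn X u v : X \in components G setT -> u \in X ->
  (v \in X) = conn setT u v.
Proof.
move=> /imsetP[w _ ->]; rewrite !inE => wu; apply/idP/idP => [|uv].
  by apply: conn_trans; rewrite connC.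
exact: conn_trans wu uv.
Qed.

(** The complement [S] of [D] connects each of the three parts. An edge [e] between the first two
    parts and an edge [f] between the last two each enlarge the span, and together with [S] they
    span everything. *)
Lemma tribond_coline D : tribond G D -> coline D.
Proof.
move=> /existsP[X1 /existsP[X2 /existsP[X3 /andP[tri /eqP DE]]]].
case/and5P: tri => _ /and3P[d12 d13 d23] cX /and3P[c1 c2 c3] /and3P[].
move=> /edge_betweenP[e [a [b [aX1 bX2 je]]]] _ /edge_betweenP[f [b' [d [b'X2 dX3 jf]]]].
have n12 u : u \in X1 -> (u \in X2) = false by apply: disjointFr.
have n13 u : u \in X1 -> (u \in X3) = false by apply: disjointFr.
have n23 u : u \in X2 -> (u \in X3) = false by apply: disjointFr.
have n21 u : u \in X2 -> (u \in X1) = false by apply: disjointFl.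
have n31 u : u \in X3 -> (u \in X1) = false by apply: disjointFl.
have n32 u : u \in X3 -> (u \in X2) = false by apply: disjointFl.
pose S := ~: D.
have SX1 : S \subset ~: delta X1 by rewrite setCS DE -setUA subsetUl.
have SX2 : S \subset ~: delta X2 by rewrite setCS DE -setUA setUCA subsetUl.
have SX3 : S \subset ~: delta X3 by rewrite setCS DE subsetUr.
have inn X : induces_connected G X ->
    [|| X == X1, X == X2 | X == X3] -> forall u v, u \in X -> v \in X -> conn S u v.
  move=> cXi eX u v; apply: induces_conn => //; apply/subsetP=> x.
  rewrite !inE DE !inE => /andP[xX x'X]; case/or3P: eX => /eqP eX; rewrite {}eX in xX x'X.
  - by rewrite xX x'X !n12 // !n13.
  - by rewrite xX x'X !n21 // !n23.
  - by rewrite xX x'X !n31 // !n32.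
have ne : e \notin span S.
  have /subsetP/(_ e) := cut_span (cut_delta X1) SX1; rewrite in_setC (delta_joins _ je).
  by rewrite aX1 (n21 _ bX2) => H; apply/negP=> /H.
have nf : f \notin span (e |: S).
  have sX3 : e |: S \subset ~: delta X3.
    by rewrite subUset SX3 sub1set in_setC (delta_joins _ je) (n13 _ aX1) (n23 _ bX2).
  have /subsetP/(_ f) := cut_span (cut_delta X3) sX3; rewrite in_setC (delta_joins _ jf).
  by rewrite dX3 (n23 _ b'X2) => H; apply/negP=> /H.
have full : span (f |: (e |: S)) = setT.
  set T := f |: _; have ST : subrel (conn S) (conn T).
    apply: conn_sub; apply: subset_trans (sub_span _ _).
    by apply: subset_trans (subsetUr _ _) (subsetUr _ _).
  have cb w : w \in X1 :|: X2 :|: X3 -> conn T w b.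
    rewrite !inE -orbA => /or3P[] wX.
    - apply: conn_trans (joins_conn _ je); last by rewrite !inE eqxx orbT.
      by apply/ST/(inn X1); rewrite ?eqxx.
    - by apply/ST/(inn X2); rewrite ?eqxx ?orbT.
    - apply: (@conn_trans _ _ _ _ b'); last by apply/ST/(inn X2); rewrite ?eqxx ?orbT.
      apply: (@conn_trans _ _ _ _ d); first by apply/ST/(inn X3); rewrite ?eqxx ?orbT.
      by rewrite connC; apply: joins_conn jf; rewrite setU11.
  apply/setP=> x; rewrite [RHS]inE.
  case: (boolP (x \in S)) => [xS|].
    by rewrite (subsetP (sub_span _ _)) //; apply/setU1P; right; apply/setU1P; right.
  have jx := joins_ends G x; rewrite (span_joins _ jx) inE negbK DE => xD.
  have cx : conn setT (ends G x).1 (ends G x).2 by apply: joins_conn jx.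
  (* An edge of [D] has an end in one of the parts, so both its ends lie in the component that the
     parts cover. *)
  have [w wX wE] : exists2 w, w \in X1 :|: X2 :|: X3 &
      w = (ends G x).1 \/ w = (ends G x).2.
    move: xD; set p := (ends G x).1; set q := (ends G x).2.
    rewrite !inE -/p -/q; case: (boolP (p \in X1 :|: X2 :|: X3)) => [pX _|].
      by exists p; auto.
    rewrite !inE -orbA !negb_or => /and3P[/negPf-> /negPf-> /negPf->].
    by rewrite /= !negbK => qX; exists q; rewrite ?inE; auto.
  have pX : (ends G x).1 \in X1 :|: X2 :|: X3.
    by case: wE wX => -> // wX; rewrite (component_conn _ cX wX) connC.
  have qX : (ends G x).2 \in X1 :|: X2 :|: X3.
    by rewrite (component_conn _ cX pX).
  by apply: conn_trans (cb _ pX) _; rewrite connC cb.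
exists S.
  by rewrite (ncomp_add ne) (ncomp_add nf); have /span_full_ncomp-> := full.
rewrite -[D]setCK; congr (~: _); apply/eqP.
rewrite eqEsubset sub_span /= DE !setCU !subsetI.
by rewrite !cut_span ?cut_delta.
Qed.

(** Two distinct hyperplanes through a flat of corank two have complements forming a modular pair,
    so a coline that is not a tribond is a dibond. *)
Lemma colineP D : reflect (coline D) (tribond G D || dibond G D).
Proof.
apply: (iffP orP) => [[/tribond_coline//|]|lD].
  case/andP=> /existsP[B1 /existsP[B2 /andP[m12 /eqP->]]] _.
  exact: modular_pair_coline.
case: (boolP (tribond G D)) => tD; [by left | right; rewrite /dibond tD andbT].
have [S [e [f [nS ne nf DE]]]] := coline_hypers lD.
have [nfS nef] := notin_span_swap ne nf.
apply/existsP; exists (~: span (e |: S)); apply/existsP; exists (~: span (f |: S)).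
rewrite DE eqxx andbT; apply/and3P; split; try by apply/hyper_bond/corank2_hyper.
by rewrite -setCI setCK corank2_setI // addn2 -/(ncomp _) ncomp_span nS.
Qed.

End Cuts.

(** * Linear classes over sets of corank two, and cobalanced edge sets *)

Section Linear.
Variables (V E : finType) (G : multigraph V E).
Implicit Types (e f x : E) (F S T B D : {set E}) (X Y : {set V}) (u v w : V).
Local Notation conn := (conn G).
Local Notation span := (span G).
Local Notation ncomp := (ncomp G).
Local Notation delta := (delta G).
Local Notation cut := (cut G).

Definition block S u : {set V} := [set v | conn S u v].

Lemma block_induces S u : induces_connected G (block S u).
Proof.
suff H w : w \in block S u -> connect (adjacent G (inner_edges G (block S u))) u w.
  apply/forall_inP=> v /H; rewrite -/(conn _ _ _) connC => vu; apply/forall_inP => w /H.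
  exact: connect_trans vu.
rewrite inE => /connectP[p pp ->]; elim/last_ind: p pp => [|p z IH] /=.
  by rewrite connect0.
rewrite rcons_path last_rcons => /andP[pp /exists_inP[x xS jx]].
apply: connect_trans (IH pp) _; apply/connect1/exists_inP; exists x => //.
have lu : conn S u (last u p) by apply/connectP; exists p.
have zu : conn S u z := conn_trans lu (joins_conn xS jx).
by have [[E1 E2]|[E1 E2]] := joinsP jx; rewrite !inE -E1 -E2 lu zu.
Qed.

Lemma block_delta S u : S \subset ~: delta (block S u).
Proof.
apply/subsetP=> x xS; rewrite !inE negbK; apply/eqP.
have c := joins_conn xS (joins_ends G x).
by apply/idP/idP => H; apply: conn_trans H _; rewrite // connC.
Qed.

(* Contracting the corank-two set [S] leaves, up to isolated vertices, a graph
   on the three blocks of [a], [b] and [d], in which [e] joins the first two and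
   [f] the last two; an edge [g] parallel to neither then completes a triangle. *)
Section Triple.
Variables (S : {set E}) (e f : E) (a b b' d : V).
Hypotheses (nS : ncomp S = (ncomp setT).+2) (ne : e \notin span S)
  (nf : f \notin span (e |: S)) (je : joins G e a b) (jf : joins G f b' d)
  (bb' : conn S b b').

Let r := root (adjacent G S).

Lemma triple_neq : [/\ r a != r b, r b != r d & r a != r d].
Proof.
have rb : r b' = r b by apply/esym/eqP; rewrite -conn_root.
move: ne nf; rewrite (span_joins _ je) (span_joins _ jf) (conn_add _ _ _ je).
rewrite !conn_root -/r !rb eqxx => -> /=; rewrite !negb_or => /and3P[-> _ ->]; by [].
Qed.

Lemma triple_span : span (f |: (e |: S)) = setT.
Proof. exact/hyper_add/nf/corank2_hyper. Qed.

Lemma triple_conn u v : conn setT u v =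
  (r u == r v) || (r u \in [:: r a; r b; r d]) && (r v \in [:: r a; r b; r d]).
Proof.
have rb : r b' = r b by apply/esym/eqP; rewrite -conn_root.
have -> : conn setT u v = conn (f |: (e |: S)) u v.
  apply/idP/idP; apply: conn_sub; first by rewrite triple_span subsetT.
  exact: subset_trans (subsetT _) (sub_span _ _).
have [nab nbd nad] := triple_neq.
rewrite (conn_add _ _ _ jf) !(conn_add _ _ _ je) !conn_root -/r !rb !inE.
move: (r u) (r v) (r a) (r b) (r d) nab nbd nad => x y p q s npq nqs nps.
rewrite (eq_sym q y) (eq_sym p y) (eq_sym s y) (eq_sym q p) (eq_sym s p) (eq_sym s q).
rewrite !eqxx (negPf npq) (negPf nqs) (negPf nps) !andbF !andbT !orbF /=.
have [nqp nsq nsp] : [/\ q != p, s != q & s != p] by split; rewrite eq_sym.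
(* Only the coincidences of [x] and [y] with [p], [q] and [s] matter, which leaves sixteen cases. *)
have cases z : [\/ z = p, z = q, z = s | [/\ (z == p) = false, (z == q) = false
    & (z == s) = false]].
  case: (eqVneq z p) => [->|_]; first by constructor 1.
  case: (eqVneq z q) => [->|_]; first by constructor 2.
  by case: (eqVneq z s) => [->|_]; [constructor 3 | constructor 4].
case: (cases x) => [->|->|->|[-> -> ->]]; case: (cases y) => [->|->|->|[-> -> ->]];
  rewrite ?eqxx ?(negPf npq) ?(negPf nqs) ?(negPf nps) ?(negPf nqp) ?(negPf nsq)
    ?(negPf nsp) ?andbF ?orbF ?orbT ?andbT //.
Qed.

Lemma triple_tripartition g : g \notin span (e |: S) -> g \notin span (f |: S) ->
  tripartition G (block S a) (block S b) (block S d).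
Proof.
move=> nge ngf; have [nab nbd nad] := triple_neq.
have rb : r b' = r b by apply/esym/eqP; rewrite -conn_root.
have inB w v : (v \in block S w) = (r w == r v) by rewrite inE conn_root.
have dis v w : r v != r w -> [disjoint block S v & block S w].
  move=> nvw; rewrite disjoint_subset; apply/subsetP=> x; rewrite inB => /eqP E1.
  by rewrite !inE conn_root -/r -E1 eq_sym.
have bet x v w v' w' : joins G x v' w' -> r v = r v' -> r w = r w' ->
    edge_between G (block S v) (block S w).
  by move=> j e1 e2; apply/edge_betweenP; exists x, v', w'; rewrite !inB e1 e2.
apply/and5P; split.
- by apply/and3P; split; apply/set0Pn;
    [exists a | exists b | exists d]; rewrite inB.
- by rewrite !dis.
- have -> : block S a :|: block S b :|: block S d = [set v in [set: V] | conn setT b v].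
    apply/setP=> v; rewrite in_setU in_setU !inB !inE triple_conn !inE eqxx !orbT /=.
    by rewrite !(eq_sym (r v)); case: (r a == r v); case: (r b == r v).
  by apply: imset_f; rewrite inE.
- by rewrite !block_induces.
have eab : edge_between G (block S a) (block S b) by apply: bet je _ _.
have ebd : edge_between G (block S b) (block S d) by apply: bet jf _ _.
rewrite eab ebd andbT /=.
have jg := joins_ends G g; move: nge ngf jg; rewrite !(span_joins _ (joins_ends G g)).
set u := (ends G g).1; set v := (ends G g).2.
have : conn setT u v by apply: joins_conn (joins_ends G g); rewrite inE.
rewrite triple_conn (conn_add _ _ _ je) (conn_add _ _ _ jf) !conn_root -/r rb.
case/orP=> [->//|/andP[]]; rewrite !inE => + + + + jg.
have jg' : joins G g v u by rewrite joinsC.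
(* Of the nine cases, those with [g] inside a block or parallel to [e] or [f] contradict the
   hypotheses; the two orientations of an edge between the blocks of [a] and [d] survive. *)
move=> /or3P[] /eqP eu /or3P[] /eqP ev; rewrite eu ev ?eqxx ?orbT //= => _ _.
- exact: bet jg _ _.
- exact: bet jg' _ _.
Qed.
End Triple.

Lemma hyper_span_unique S e H : ncomp (e |: S) = (ncomp setT).+1 -> cut H ->
  H != set0 -> S \subset ~: H -> e \notin H -> H = ~: span (e |: S).
Proof.
move=> nS cH nH SH eH; apply: hyper_unique => //.
by rewrite subUset sub1set inE eH.
Qed.

(** Among the bonds avoiding a set of corank two, two members of [L] force a third bond into [L]:
    the three are the cuts of the parts of a tripartition. *)
Lemma linear_corank2 L S e f H : linear_class G L ->
  ncomp S = (ncomp setT).+2 -> e \notin span S -> f \notin span (e |: S) ->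
  ~: span (e |: S) \in L -> ~: span (f |: S) \in L ->
  bond G H -> S \subset ~: H -> e \in H -> f \in H -> H \in L.
Proof.
move=> [_ linL] nS ne nf Le Lf bH SH eH fH.
have [nfS nef] := notin_span_swap ne nf.
have nSe := corank2_hyper nS ne; have nSf := corank2_hyper nS nfS.
have ce := hyper_cut nSe; have cf := hyper_cut nSf.
have full : span (f |: (e |: S)) = setT by exact/hyper_add.
have [nH cH mH] := bondP _ _ bH.
have unique D : cut D -> S \subset ~: D -> e \in D -> f \in D -> D = H.
  move=> cD SD eD fD; apply: (cut_eq cD cH full) => x.
  rewrite !inE => /or3P[/eqP->|/eqP->|xS]; rewrite ?eD ?fD ?eH ?fH //.
  move/subsetP/(_ x xS): SD; move/subsetP/(_ x xS): SH.
  by rewrite !inE => /negPf-> /negPf->.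
(* If no edge lay outside both hyperplanes, their complements would be disjoint and their union a
   cut agreeing with [H] on a spanning set; the bond [H] would then properly contain a bond. *)
have [g] : exists g, g \in ~: span (e |: S) :&: ~: span (f |: S).
  apply/set0Pn/eqP=> I0; have HU : ~: span (e |: S) :|: ~: span (f |: S) = H.
    have -> : ~: span (e |: S) :|: ~: span (f |: S)
        = [set x | (x \in ~: span (e |: S)) (+) (x \in ~: span (f |: S))].
      apply/setP=> x; have := in_set0 x; rewrite -I0 !inE.
      by case: conn; case: conn.
    apply: unique; first exact: cutD.
    - apply/subsetP=> x xS; rewrite in_setC in_set !in_setC.
      by rewrite !(subsetP (sub_span _ _) x) ?in_setU ?xS ?orbT.
    - by rewrite in_set !in_setC (negPf nef) (subsetP (sub_span _ _)) ?setU11.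
    - by rewrite in_set !in_setC (negPf nf) (subsetP (sub_span _ _)) ?setU11.
  have : ~: span (e |: S) = H.
    by have [n0 _ _] := bondP _ _ (hyper_bond nSe); apply: mH; rewrite // -HU subsetUl.
  by move/setP/(_ e); rewrite eH in_setC (subsetP (sub_span _ _)) ?setU11.
rewrite in_setI !in_setC => /andP[nge ngf].
(* The ends of [e] and [f] may be named so that the two edges share a block. If they shared none,
   [g] could not lie in the span of [f |: (e |: S)] without lying in that of [e |: S] or of
   [f |: S]. *)
suff main a b b' d : joins G e a b -> joins G f b' d -> conn S b b' -> H \in L.
  have je := joins_ends G e; have jf := joins_ends G f; move: nge ngf.
  rewrite !(span_joins _ (joins_ends G g)).
  have : g \in span (f |: (e |: S)) by rewrite full inE.
  rewrite (span_joins _ (joins_ends G g)).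
  move: je jf; set a := (ends G e).1; set b := (ends G e).2.
  set c := (ends G f).1; set d := (ends G f).2.
  set u := (ends G g).1; set v := (ends G g).2 => je jf.
  have je' : joins G e b a by rewrite joinsC.
  have jf' : joins G f d c by rewrite joinsC.
  case: (boolP (conn S b c)) => [bc _ _ _|nbc]; first exact: main je jf bc.
  case: (boolP (conn S b d)) => [bd _ _ _|nbd]; first exact: main je jf' bd.
  case: (boolP (conn S a c)) => [ac _ _ _|nac]; first exact: main je' jf ac.
  case: (boolP (conn S a d)) => [ad _ _ _|nad]; first exact: main je' jf' ad.
  rewrite (conn_add _ _ _ jf) !(conn_add _ _ _ je) (conn_add _ _ _ jf).
  rewrite ![conn S c _]connC ![conn S d _]connC ![conn S v _]connC.
  by rewrite (negPf nbc) (negPf nbd) (negPf nac) (negPf nad) !andbF !orbF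
    => /orP[/orP[->//|->]|->]; rewrite ?orbT.
move=> je jf bb'.
have tri := triple_tripartition nS ne nf je jf bb' nge ngf.
have [nab nbd nad] := triple_neq ne nf je jf bb'.
have inB w v : (v \in block S w) = (root (adjacent G S) w == root (adjacent G S) v).
  by rewrite inE conn_root.
have rb : root (adjacent G S) b' = root (adjacent G S) b.
  by apply/esym/eqP; rewrite -conn_root.
(* A nonempty cut avoiding [S] is determined by which of [e] and [f] it contains, and this
   identifies the cuts of the three blocks. *)
have da : delta (block S a) = ~: span (f |: S).
  apply: hyper_span_unique => //; rewrite ?cut_delta ?block_delta //.
    by apply/set0Pn; exists e; rewrite (delta_joins _ je) !inB eqxx (negPf nab).
  by rewrite (delta_joins _ jf) !inB rb (negPf nab) (negPf nad).
have dd : delta (block S d) = ~: span (e |: S).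
  apply: hyper_span_unique => //; rewrite ?cut_delta ?block_delta //.
    apply/set0Pn; exists f; rewrite (delta_joins _ jf) !inB rb eqxx.
    by rewrite [root _ d == _]eq_sym (negPf nbd).
  by rewrite (delta_joins _ je) !inB !(eq_sym (root _ d)) (negPf nad) (negPf nbd).
have db : delta (block S b) = H.
  apply: unique; rewrite ?cut_delta ?block_delta //.
    by rewrite (delta_joins _ je) !inB eqxx [root _ b == _]eq_sym (negPf nab).
  by rewrite (delta_joins _ jf) !inB rb eqxx (negPf nbd).
by have := linL _ _ _ tri; rewrite da dd db Le Lf; case: (H \in L).
Qed.

(** Boolean form of [cobalanced] for the partition of [F]; [~: span F] is the [Ext] of that
    partition. *)
Definition cobalb (L : {set {set E}}) F :=
  [forall B, bond G B ==> (B \subset ~: span F) ==> (B \in L)].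

Lemma Ext_components F : Ext G (components G F) = ~: span F.
Proof.
have eqR : {in [set: V] & &, equivalence_rel (connect (adjacent G F))}.
  move=> u v w _ _ _; split=> [|uv]; first exact: conn_refl.
  by apply/idP/idP; apply: conn_trans; rewrite // connC.
have /and3P[/eqP cP tP _] := equivalence_partitionP eqR.
apply/setP=> x; rewrite !inE eq_pblock ?cP ?inE //.
by rewrite pblock_equivalence_partition ?inE.
Qed.

Lemma cobalbP L F : reflect (cobalanced G L (components G F)) (cobalb L F).
Proof.
rewrite /cobalanced Ext_components; apply: (iffP forallP) => [H B bB BF|H B].
  by have /implyP/(_ bB)/implyP/(_ BF) := H B.
by apply/implyP=> bB; apply/implyP; apply: H.
Qed.

Lemma cobalb_span L F S : F \subset span S -> cobalb L F -> cobalb L S.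
Proof.
move=> FS /forallP H; apply/forallP=> B; apply/implyP=> bB; apply/implyP=> BS.
have /implyP/(_ bB)/implyP := H B; apply.
by apply: subset_trans BS _; rewrite setCS; apply: span_sub.
Qed.

(** This is the only place where linearity enters the exchange axiom. *)
Lemma cobalb_add_span L F e f : linear_class G L -> ~~ cobalb L F ->
  e \notin span F -> f \notin span (e |: F) ->
  cobalb L (e |: F) -> cobalb L (f |: F) -> False.
Proof.
move=> linL ncF ne nf ce cf; have [nfF nef] := notin_span_swap ne nf.
move: ncF; rewrite negb_forall => /existsP[B]; rewrite !negb_imply => /and3P[bB BF nLB].
have FB : F \subset ~: B.
  by rewrite -subsetC; apply: subset_trans BF _; rewrite setCS sub_span.
have [_ cB _] := bondP _ _ bB.
(* If [B] missed [x], it would avoid [x |: F], and cobalance would put it in [L]. *)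
have inB x : cobalb L (x |: F) -> x \in B.
  move=> /forallP/(_ B); rewrite bB /= => /implyP H; apply: contraNT nLB => xB.
  by apply: H; rewrite subsetC cut_span // subUset FB sub1set inE xB.
have eB := inB e ce; have fB := inB f cf.
(* [T] is maximal inside the hyperplane [~: B] subject to [e] and [f] staying independent over
   it. *)
pose P T := (T \subset ~: B) && (f \notin span (e |: T)).
have [T /maxsetP[/andP[TB nfT] mT] FT] := @maxset_exists _ P F (introT andP (conj FB nf)).
have neT : e \notin span T.
  by apply/negP=> /(subsetP (cut_span cB TB)); rewrite inE eB.
have [nfT' neT'] := notin_span_swap neT nfT.
have n2 : ncomp T = (ncomp (f |: (e |: T))).+2 by rewrite (ncomp_add neT) (ncomp_add nfT).
have nT : ncomp T = (ncomp setT).+2.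
  rewrite n2; congr _.+2; apply/eqP; rewrite eqn_leq ncomp_ge andbT leqNgt.
  (* If the corank were larger, some edge of [~: B] would lie outside the span of [T] with [e] and
     [f], and by exchange it could be added to [T]. *)
  apply/negP=> lt; have : span (e |: ~: B) = setT.
    by apply: hyper_add; [exact: bond_hyper | rewrite bond_span // inE eB].
  move=> full; have /ncomp_lt[x xB nx] : ncomp (e |: ~: B) < ncomp (f |: (e |: T)).
    by have /span_full_ncomp-> := full.
  case/setU1P: xB nx => [->|xB] nx.
    by rewrite (subsetP (sub_span _ _)) // !inE eqxx orbT in nx.
  have nxT : x \notin T.
    by apply: contra nx => xT; rewrite (subsetP (sub_span _ _)) // !inE xT !orbT.
  move: nxT; rewrite -(mT (x |: T)) ?setU11 ?subsetUr //.
  rewrite /P subUset sub1set xB TB /= setUCA; apply/negP.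
  move=> /span_exchange/(_ nfT); apply/negP; exact: nx.
have FsT x : cobalb L (x |: F) -> x \notin span T -> ~: span (x |: T) \in L.
  move=> cx nx; have : cobalb L (x |: T).
    by apply: cobalb_span cx; apply: subset_trans (sub_span _ _); apply: setUS.
  move=> /forallP/(_ (~: span (x |: T))).
  by rewrite hyper_bond ?subxx //; apply: corank2_hyper.
move/negP: nLB; apply.
by apply: (linear_corank2 linL nT neT nfT) => //; apply: FsT.
Qed.

End Linear.

(** * Matroids and their cocircuits *)

Section Cocircuits.
Variable T : finType.
Implicit Types (M N : matroid T) (A B C I : {set T}).

Lemma indep_sub M A B : B \subset A -> A \in indep M -> B \in indep M.
Proof.
by have /and3P[_ /forall_inP H _] := indepP M => BA /H/forallP/(_ B)/implyP; apply.
Qed.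

Lemma indep_augment M A B : A \in indep M -> B \in indep M -> #|A| < #|B| ->
  exists2 x, x \in B :\: A & x |: A \in indep M.
Proof.
have /and3P[_ _ /forall_inP H] := indepP M.
by move=> /H/forall_inP/[apply]/implyP/[apply]/exists_inP.
Qed.

Lemma indep_base M I : reflect (exists2 B, base M B & I \subset B) (I \in indep M).
Proof.
apply: (iffP idP) => [iI|[B /maxsetp iB IB]]; last exact: indep_sub IB iB.
by have [B mB IB] := maxset_exists (P := fun A => A \in indep M) iI; exists B.
Qed.

Lemma base_card M B I : base M B -> I \in indep M -> #|I| <= #|B|.
Proof.
move=> /maxsetP[iB mB] iI; rewrite leqNgt; apply/negP=> /(indep_augment iB iI)[x].
rewrite inE => /andP[xB _] /mB/(_ (subsetUr _ _)) E1.
by rewrite -E1 setU11 in xB.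
Qed.

Lemma base_eq_card M B I : base M B -> I \in indep M -> #|I| = #|B| -> base M I.
Proof.
move=> bB iI cI; apply/maxsetP; split=> // J iJ IJ; apply/esym/eqP.
by rewrite eqEcard IJ cI (base_card bB iJ).
Qed.

Lemma coindep_sub M A A' : A' \subset A -> coindep M A -> coindep M A'.
Proof.
move=> AA /existsP[B /andP[bB AB]]; apply/existsP; exists B.
by rewrite bB (subset_trans AA).
Qed.

Lemma coindepPn M A :
  reflect (exists2 C, C \in cocircuits M & C \subset A) (~~ coindep M A).
Proof.
apply: (iffP idP) => [nA|[C]].
  have [C mC CA] := minset_exists (P := fun A => ~~ coindep M A) nA.
  by exists C; rewrite ?inE.
by rewrite inE => /minsetp nC CA; apply: contra nC; apply: coindep_sub.
Qed.

(** The sets containing a cocircuit are those that are not coindependent, so coindependence agrees.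
    A base of one matroid then contains a base of the other, which contains a base of the first;
    equal cardinality makes all three equal. *)
Lemma eq_cocircuits_indep M N : cocircuits M = cocircuits N -> indep M = indep N.
Proof.
move=> cMN; have eMN A : coindep M A = coindep N A.
  by apply: negb_inj; apply/coindepPn/coindepPn; rewrite cMN.
have sub M1 M2 (e12 : coindep M1 =1 coindep M2) B : base M1 B ->
    exists2 B', base M2 B' & B' \subset B.
  move=> bB; have : coindep M2 (~: B).
    by rewrite -e12; apply/existsP; exists B; rewrite bB subxx.
  by case/existsP=> B' /andP[bB']; rewrite setCS; exists B'.
have bases M1 M2 (e12 : coindep M1 =1 coindep M2) B : base M1 B -> base M2 B.
  move=> bB; have [B' bB' B'B] := sub _ _ e12 B bB.
  have [B'' bB'' B''B'] := sub _ _ (fsym e12) B' bB'.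
  have EB : B'' = B.
    apply/eqP; rewrite eqEcard (subset_trans B''B') //= (base_card bB'') //.
    by have /maxsetp := bB.
  suff -> : B = B' by [].
  by apply/eqP; rewrite eqEsubset B'B -{1}EB B''B'.
apply/setP=> I; apply/indep_base/indep_base => -[B bB IB]; exists B => //.
  exact: bases bB.
by apply: (bases N M) bB => A; rewrite eMN.
Qed.

Lemma cocircuitsE M (K : {set {set T}}) :
  (forall C, C \in K -> ~~ coindep M C) ->
  (forall A, ~~ coindep M A -> exists2 C, C \in K & C \subset A) ->
  (forall C C', C \in K -> C' \in K -> C' \subset C -> C' = C) ->
  cocircuits M = K.
Proof.
move=> Kco coK Kanti; apply/setP=> C; rewrite inE; apply/minsetP/idP => [[nC mC]|CK].
  by have [C' C'K C'C] := coK C nC; rewrite -(mC C') ?Kco.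
split=> [|C' /coK[C'' C''K C''C'] C'C]; first exact: Kco.
have EC := Kanti C C'' CK C''K (subset_trans C''C' C'C).
by apply/eqP; rewrite eqEsubset C'C -EC.
Qed.

End Cocircuits.

(** * Edge sets with and without e_0 *)

Section OptionSets.
Variable E : finType.
Implicit Types (F : {set E}) (I J : {set option E}).

Definition edges I : {set E} := Some @^-1: I.

Lemma lift_edgesK : cancel (@lift_edges E) edges.
Proof. by move=> F; apply/setP=> x; rewrite inE mem_imset //; apply: Some_inj. Qed.

Lemma None_lift_edges F : None \in lift_edges F = false.
Proof. by apply/negbTE/imsetP=> -[]. Qed.

Lemma add_e0K : cancel (@add_e0 E) edges.
Proof. by move=> F; apply/setP=> x; rewrite !inE /= mem_imset //; apply: Some_inj. Qed.

Lemma None_add_e0 F : None \in add_e0 F.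
Proof. exact: setU11. Qed.

Lemma edgesK I : None \notin I -> lift_edges (edges I) = I.
Proof.
move=> nI; apply/setP=> -[x|]; last by rewrite (negPf nI) None_lift_edges.
by rewrite mem_imset ?inE //; apply: Some_inj.
Qed.

Lemma edges_e0K I : None \in I -> add_e0 (edges I) = I.
Proof.
move=> nI; apply/setP=> -[x|]; last by rewrite nI None_add_e0.
by rewrite !inE mem_imset ?inE //; apply: Some_inj.
Qed.

Lemma card_edges I : #|I| = (None \in I) + #|edges I|.
Proof.
case: (boolP (None \in I)) => nI; last first.
  by rewrite -{1}(edgesK nI) card_imset //; apply: Some_inj.
rewrite -{1}(edges_e0K nI) cardsU1 None_lift_edges card_imset //.
exact: Some_inj.
Qed.

Lemma edges_add e I : edges (Some e |: I) = e |: edges I.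
Proof. by apply/setP=> x; rewrite !inE. Qed.

Lemma edges_addN I : edges (None |: I) = edges I.
Proof. by apply/setP=> x; rewrite !inE. Qed.

Lemma option_subset I J : (I \subset J) =
  ((None \in I) ==> (None \in J)) && (edges I \subset edges J).
Proof.
apply/subsetP/andP => [IJ|[/implyP nIJ /subsetP IJ]].
  by split; [apply/implyP/IJ | apply/subsetP=> x; rewrite !inE; apply: IJ].
by move=> [x|//] xI; have := IJ x; rewrite !inE; apply.
Qed.
End OptionSets.

(** * The extension by e_0: independent sets, bases and cocircuits *)

Section J0Matroid.
Variables (V E : finType) (G : multigraph V E) (L : {set {set E}}).
Hypothesis linL : linear_class G L.
Implicit Types (e f x : E) (F S B D : {set E}) (A C I : {set option E}).
Local Notation span := (span G).
Local Notation ncomp := (ncomp G).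
Local Notation cobalb := (cobalb G L).

(** A boolean family is required, so forests appear through the rank equation of [forestP]. *)
Definition J0_indep : {set {set option E}} :=
  [set I | (ncomp (edges I) + #|edges I| == #|V|)
         && ((None \in I) ==> ~~ cobalb (edges I))].

(** Augmentation splits on whether [A] contains e_0: only then must the enlarged edge set stay
    un-cobalanced. *)
Lemma J0_axioms : matroid_axioms J0_indep.
Proof.
apply/and3P; split.
- rewrite inE (_ : edges set0 = set0) ?inE; last by apply/setP=> x; rewrite !inE.
  by rewrite andbT; apply/forestP/forest0.
- apply/forall_inP=> A; rewrite inE => /andP[/forestP fA /implyP cA].
  apply/forallP=> B; apply/implyP; rewrite option_subset => /andP[/implyP nBA BA].
  rewrite inE; apply/andP; split; first by apply/forestP/(forest_sub BA).
  apply/implyP=> /nBA/cA; apply: contra; apply: cobalb_span.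
  exact: subset_trans BA (sub_span _ _).
apply/forall_inP=> A; rewrite inE => /andP[/forestP fA /implyP cA].
apply/forall_inP=> B; rewrite inE => /andP[/forestP fB /implyP cB].
apply/implyP; rewrite !card_edges.
have nA := forest_card fA; have nB := forest_card fB.
set F1 := edges A in fA cA nA *; set F2 := edges B in fB cB nB *.
have addS e : e \in F2 -> e \notin span F1 -> (None \in A -> ~~ cobalb (e |: F1)) ->
    [exists x in B :\: A, x |: A \in J0_indep].
  move=> eF2 ne ce; apply/exists_inP; exists (Some e).
    rewrite inE -[Some e \in A]/(true && _) andbC; apply/andP; split; last first.
      by apply: contra ne => eA; rewrite (subsetP (sub_span _ _)) // inE.
    by rewrite inE in eF2.
  rewrite inE edges_add; apply/andP; split; first exact/forestP/forest_add.
  by apply/implyP=> /setU1P[].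
case: (boolP (None \in A)) => nAN lt.
  have lt12 : ncomp F2 < ncomp F1.
    rewrite -(ltn_add2r (#|F1| + #|F2|)) addnA [ncomp F1 + _]addnA nA.
    rewrite addnAC nB ltn_add2l.
    by move: lt; case: (None \in B) => //=; rewrite !add1n ?add0n // => /ltnW.
  have [e eF2 ne] := ncomp_lt lt12.
  case: (boolP (cobalb (e |: F1))) => [ce|nce]; last by apply: addS ne _.
  (* If [F2] lies in the span of [e |: F1], counting puts e_0 in [B] and makes the spans equal, so
     [F2] would be cobalanced. Otherwise there is a second edge [f], and by [cobalb_add_span] it can
     be added. *)
  case: (boolP (F2 \subset span (e |: F1))) => [F2e|].
    have ne1 := ncomp_add ne; have le2 := ncomp_sub F2e.
    have nB' : None \in B.
      move: lt; case: (None \in B) => //; rewrite add1n add0n => lt.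
      have : #|V| < #|V|; last by rewrite ltnn.
      rewrite -{1}nA -nB ne1 addSnnS -addnS.
      exact: leq_add.
    have e2 : ncomp F2 = ncomp (e |: F1).
      apply/eqP; rewrite eqn_leq le2 andbT -ltnS -ne1 //.
    case/negP: (cB nB'); apply: cobalb_span ce.
    by rewrite (span_eq F2e e2) sub_span.
  case/subsetPn=> f fF2 nf; have [nfF1 _] := notin_span_swap ne nf.
  case: (boolP (cobalb (f |: F1))) => [cf|ncf]; last by apply: addS nfF1 _.
  by case: (cobalb_add_span linL (cA nAN) ne nf ce cf).
(* If no edge of [F2] enlarges the span of [F1], counting puts e_0 in [B] and makes the spans equal;
   e_0 can then be added to [A] because [F2] is un-cobalanced. *)
case: (boolP (F2 \subset span F1)) => [F21|/subsetPn[e eF2 ne]]; last first.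
  by apply: addS eF2 ne _ => nN; rewrite nN in nAN.
have le12 := ncomp_sub F21.
have le21 : #|F2| <= #|F1|.
  by rewrite -(leq_add2l (ncomp F2)) nB -nA leq_add2r.
have nBN : None \in B.
  by move: lt; case: (None \in B) => //; rewrite ltnNge le21.
have eF : ncomp F2 = ncomp F1.
  apply/eqP; rewrite eqn_leq le12 andbT -(leq_add2r #|F2|) nB -nA leq_add2l.
  by move: lt; rewrite nBN add1n ltnS.
apply/exists_inP; exists None; first by rewrite inE nAN.
rewrite inE edges_addN setU11; apply/andP; split; first exact/forestP.
apply: contra (cB nBN); apply: cobalb_span.
by rewrite (span_eq F21 eF) sub_span.
Qed.

Definition J0_matroid : matroid (option E) := Matroid J0_axioms.

Lemma J0_indepP I : I \in indep J0_matroid <->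
    (exists F : {set E}, forest G F /\ I = lift_edges F) \/
    (exists F : {set E},
       [/\ forest G F, ~ cobalanced G L (components G F) & I = add_e0 F]).
Proof.
rewrite /= inE; split=> [/andP[/forestP fI /implyP cI]|].
  case: (boolP (None \in I)) => nI; [right | left]; exists (edges I).
    by split; rewrite ?edges_e0K //; apply/cobalbP/cI.
  by rewrite edgesK.
case=> [[F [fF ->]]|[F [fF cF ->]]].
  by rewrite lift_edgesK None_lift_edges andbT; apply/forestP.
rewrite add_e0K None_add_e0; apply/andP; split; first exact/forestP.
exact/cobalbP.
Qed.

(** No bond avoids a spanning set, which is therefore vacuously cobalanced. *)
Lemma uncobal_ncomp F : ~~ cobalb F -> ncomp setT < ncomp F.
Proof.
move=> ncF; rewrite ltn_neqAle ncomp_ge andbT eq_sym; apply: contra ncF.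
move=> /eqP/span_full_ncomp sF; apply/forallP=> B; apply/implyP=> /bondP[nB _ _].
by rewrite sF setCT subset0 (negPf nB).
Qed.

(** A spanning forest attains the size given here, and no independent set exceeds it, even with e_0,
    because un-cobalanced sets do not span. The sets [I] are therefore the bases avoiding [A]. *)
Lemma coindep_J0P A : reflect
  (exists I, [/\ I \in J0_indep, ncomp setT + #|I| = #|V| & I \subset ~: A])
  (coindep J0_matroid A).
Proof.
have full : exists2 I, I \in indep J0_matroid & ncomp setT + #|I| = #|V|.
  have [F [fF _ _ sF]] := forest_extend (@forest0 V E G) (sub0set setT).
  exists (lift_edges F); first by apply/J0_indepP; left; exists F.
  rewrite card_imset; last exact: Some_inj.
  by rewrite -(forest_card fF); congr (_ + _); rewrite -ncomp_span -sF ncomp_span.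
have bound I : I \in indep J0_matroid -> ncomp setT + #|I| <= #|V|.
  rewrite inE => /andP[/eqP<- /implyP cI]; rewrite card_edges addnA leq_add2r.
  by case: (None \in I) cI => [/(_ isT)/uncobal_ncomp|_]; rewrite ?addn1 ?addn0 ?ncomp_ge.
apply: (iffP existsP) => [[B /andP[bB AB]]|[I [iI cI IA]]].
  exists B; have iB : B \in indep J0_matroid by have /maxsetp := bB.
  split=> //; last by rewrite subsetC.
  have [J iJ cJ] := full.
  by apply/eqP; rewrite eqn_leq bound //= -cJ leq_add2l; apply: (base_card bB iJ).
exists I; rewrite subsetC IA andbT; have /(indep_base J0_matroid)[B bB _] := iI.
apply: (base_eq_card bB) => //; apply/eqP; rewrite eqn_leq (base_card bB) //=.
by rewrite -(leq_add2l (ncomp setT)) cI bound //; have /maxsetp := bB.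
Qed.

Lemma J0_cocircuitsP C : reflect
  (if None \in C then bond G (edges C) /\ edges C \notin L
   else edges C \in L \/
     coline G (edges C) /\ forall B, B \in L -> ~~ (B \subset edges C))
  (C \in J0_cocircuits G L).
Proof.
apply: (iffP idP) => [|].
  case/setUP=> [/setUP[]|] /imsetP[B].
  - by move=> BL ->; rewrite None_lift_edges lift_edgesK; left.
  - by rewrite inE => /andP[bB nB] ->; rewrite None_add_e0 add_e0K.
  - rewrite inE => /andP[/colineP lB /forall_inP nB] ->.
    by rewrite None_lift_edges lift_edgesK; right.
case: (boolP (None \in C)) => nC.
  move=> [bC nL]; apply/setUP; left; apply/setUP; right; apply/imsetP.
  by exists (edges C); rewrite ?edges_e0K // inE bC.
case=> [CL|[lC nL]]; apply/setUP; [left; apply/setUP; left | right]; apply/imsetP;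
  exists (edges C); rewrite ?edgesK // inE.
by apply/andP; split; [apply/colineP | apply/forall_inP].
Qed.

Lemma coline_two_bonds D : coline G D -> exists B1 B2,
  [/\ bond G B1, bond G B2, B1 != B2 & D = B1 :|: B2].
Proof.
case/coline_hypers=> S [e [f [nS ne nf ->]]].
have [nfS nef] := notin_span_swap ne nf.
exists (~: span (e |: S)), (~: span (f |: S)); split=> //.
- exact/hyper_bond/corank2_hyper.
- exact/hyper_bond/corank2_hyper.
apply/eqP=> /setP/(_ e); rewrite !in_setC nef (subsetP (sub_span _ _)) ?setU11 //.
Qed.

(** As [C] contains a bond, the edges of a base [I] avoiding [C] do not span. So [I] contains e_0,
    its edges have corank one, and [C] contains exactly one bond. That excludes a coline, which
    contains two, and a bond of [L], which would make the edges of [I] cobalanced. *)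
Lemma J0_cocircuit_dep C : C \in J0_cocircuits G L -> ~~ coindep J0_matroid C.
Proof.
move=> /J0_cocircuitsP CK; apply/coindep_J0P=> -[I [iI cI IC]].
have IC' : edges I \subset ~: edges C.
  by apply/subsetP=> x; rewrite !inE => /(subsetP IC); rewrite inE.
have [Lb _] := linL; move: iI; rewrite inE => /andP[/forestP fI /implyP cob].
have nI := forest_card fI; rewrite card_edges addnA in cI.
have bnd B : bond G B -> B \subset edges C -> ncomp (edges I) != ncomp setT.
  move=> /bondP[nB cB _] BC; apply/eqP=> /span_full_ncomp/(cut_meets cB nB).
  by rewrite (subset_trans IC') // setCS.
have exB : exists2 B, bond G B & B \subset edges C.
  case: (None \in C) CK => [[bC _]|[/Lb bC|[lC _]]]; try by exists (edges C).
  by have [B1 [B2 [b1 _ _ ->]]] := coline_two_bonds lC; exists B1; rewrite ?subsetUl.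
have [B bB BC] := exB; have := bnd B bB BC.
move/eqP: cI; rewrite -nI eqn_add2r; case: (boolP (None \in I)) => nIN; last first.
  by rewrite addn0 eq_sym => ->.
rewrite addn1 eq_sym => /eqP hI _.
have hB D : bond G D -> D \subset edges C -> D = ~: span (edges I).
  move=> /bondP[nD cD _] DC; apply: hyper_unique => //.
  by rewrite (subset_trans IC') // setCS.
have nCN : None \notin C by have := subsetP IC None nIN; rewrite inE.
rewrite (negPf nCN) in CK; case: CK => [CL|[lC _]]; last first.
  have [B1 [B2 [b1 b2 n12 EC]]] := coline_two_bonds lC; case/eqP: n12.
  have s1 : B1 \subset edges C by rewrite EC subsetUl.
  have s2 : B2 \subset edges C by rewrite EC subsetUr.
  exact: etrans (hB _ b1 s1) (esym (hB _ b2 s2)).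
case/negP: (cob nIN); apply/forallP=> D; apply/implyP=> /bondP[nD cD _].
apply/implyP=> DI; rewrite (_ : D = edges C) // (hB _ (Lb _ CL)) //.
apply: hyper_unique => //; rewrite subsetC.
by apply: subset_trans DI _; rewrite setCS sub_span.
Qed.

(** The argument follows the corank of [~: X]: where it is too small for a cocircuit inside [A], the
    spanning forest [F] of [~: X], alone or with e_0, is a base avoiding [A]. *)
Lemma J0_dep_cocircuit A : ~~ coindep J0_matroid A ->
  exists2 C, C \in J0_cocircuits G L & C \subset A.
Proof.
move=> dA; pose X := edges A.
have [F [fF _ FX sF]] := forest_extend (@forest0 V E G) (sub0set (~: X)).
have nF : ncomp F = ncomp (~: X) by rewrite -ncomp_span sF ncomp_span.
have lFA : lift_edges F \subset ~: A.
  by apply/subsetP=> _ /imsetP[x /(subsetP FX)+ ->]; rewrite !inE.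
have lt : ncomp setT < ncomp (~: X).
  rewrite ltn_neqAle ncomp_ge andbT; apply: contra dA => /eqP nX.
  apply/coindep_J0P; exists (lift_edges F); split=> //.
    by apply/J0_indepP; left; exists F.
  by rewrite card_imset ?nX -?nF ?forest_card //; apply: Some_inj.
have [|T XT nT] := @ncomp_extend _ _ G (~: X) (ncomp setT).+1; first by rewrite leqnSn.
have bT := hyper_bond nT.
have TX : ~: span T \subset X by rewrite subCset (subset_trans XT) ?sub_span.
case: (boolP (~: span T \in L)) => LT.
  exists (lift_edges (~: span T)).
    by apply/J0_cocircuitsP; rewrite None_lift_edges lift_edgesK; left.
  by rewrite option_subset None_lift_edges lift_edgesK.
case: (boolP (None \in A)) => nA.
  exists (add_e0 (~: span T)).
    by apply/J0_cocircuitsP; rewrite None_add_e0 add_e0K.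
  by rewrite option_subset nA implybT add_e0K.
case: (boolP [exists B in L, B \subset X]) => [/exists_inP[B BL BX]|].
  exists (lift_edges B).
    by apply/J0_cocircuitsP; rewrite None_lift_edges lift_edgesK; left.
  by rewrite option_subset None_lift_edges lift_edgesK.
rewrite negb_exists_in => /forall_inP nLX.
(* At corank one, [F] with e_0 would be a base avoiding [A]: the complement of [span F] is a bond
   inside [X], and [X] contains no bond of [L]. *)
have lt2 : (ncomp setT).+1 < ncomp (~: X).
  rewrite ltn_neqAle lt andbT; apply: contra dA => /eqP nX.
  apply/coindep_J0P; exists (add_e0 F); split.
  - apply/J0_indepP; right; exists F; split=> //; apply/cobalbP.
    have bX : bond G (~: span F) by apply: hyper_bond; rewrite nF.
    apply/negP=> /forallP/(_ (~: span F)); rewrite bX subxx /=; apply/negP.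
    apply: contraL (_ : ~: span F \subset X) => [/nLX//|].
    by rewrite sF subCset sub_span.
  - by rewrite card_edges None_add_e0 add_e0K addnA addn1 nX -nF forest_card.
  by rewrite subUset sub1set inE nA lFA.
have [|S XS nS] := @ncomp_extend _ _ G (~: X) (ncomp setT).+2.
  by rewrite leqW // lt2.
have SX : ~: span S \subset X by rewrite subCset (subset_trans XS) ?sub_span.
exists (lift_edges (~: span S)); last first.
  by rewrite option_subset None_lift_edges lift_edgesK.
apply/J0_cocircuitsP; rewrite None_lift_edges lift_edgesK; right.
split; first by exists S.
by move=> B /nLX; apply: contra => /subset_trans; apply.
Qed.

Lemma bond_sub B B' : bond G B -> bond G B' -> B' \subset B -> B' = B.
Proof. by move=> /bondP[_ _ mB] /bondP[nB cB _]; apply: mB. Qed.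

Lemma coline_not_sub B D : bond G B -> coline G D -> ~~ (D \subset B).
Proof.
move=> bB /coline_two_bonds[B1 [B2 [b1 b2 n12 ->]]]; rewrite subUset.
apply: contra n12 => /andP[s1 s2].
by rewrite (bond_sub bB b1 s1) (bond_sub bB b2 s2).
Qed.

Lemma coline_sub D D' : coline G D -> coline G D' -> D' \subset D -> D' = D.
Proof.
move=> [S nS ->] [S' nS' ->]; rewrite setCS => SS'; congr (~: _); apply/esym.
by apply: span_eq; rewrite ?nS //; apply: subset_trans (sub_span _ _) SS'.
Qed.

(** Bonds are incomparable, and so are colines. A coline contains two bonds and so lies in no bond,
    while a coline that is a cocircuit contains no bond of [L] by definition. *)
Lemma J0_cocircuits_antichain C C' : C \in J0_cocircuits G L ->
  C' \in J0_cocircuits G L -> C' \subset C -> C' = C.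
Proof.
move=> /J0_cocircuitsP CK /J0_cocircuitsP CK'; rewrite option_subset => /andP[nn sub].
have [Lb _] := linL.
suff [Ee En] : edges C' = edges C /\ (None \in C') = (None \in C).
  case: (boolP (None \in C)) En => [nC nC'|nC /negbT nC'].
    by rewrite -(edges_e0K nC) -(edges_e0K nC') Ee.
  by rewrite -(edgesK nC) -(edgesK nC') Ee.
case: (None \in C) (None \in C') CK CK' nn => -[] //.
- by move=> [bC _] [bC' _] _; split=> //; apply: bond_sub.
- move=> [bC nL] [CL|[lC _]] _; last by case/negP: (coline_not_sub bC lC).
  by case/negP: nL; rewrite -(bond_sub bC (Lb _ CL) sub).
- move=> [CL|[lC nC]] [CL'|[lC' nC']] _; split=> //.
  + exact: bond_sub (Lb _ CL) (Lb _ CL') sub.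
  + by case/negP: (coline_not_sub (Lb _ CL) lC').
  + by case/negP: (nC _ CL').
  + exact: coline_sub.
Qed.

Lemma J0_matroid_cocircuits : cocircuits J0_matroid = J0_cocircuits G L.
Proof.
apply: cocircuitsE.
- exact: J0_cocircuit_dep.
- exact: J0_dep_cocircuit.
- exact: J0_cocircuits_antichain.
Qed.

(** [J0_matroid] witnesses that the search in [J0] succeeds, so its default is not reached;
    whichever matroid is picked has the same cocircuits. *)
Lemma J0_indepE : indep (J0 G L) = indep J0_matroid.
Proof.
apply: eq_cocircuits_indep; rewrite /J0; case: pickP => [M /eqP|/(_ J0_matroid)].
  by rewrite J0_matroid_cocircuits.
by rewrite J0_matroid_cocircuits eqxx.
Qed.

End J0Matroid.

Theorem theorem3p5 (V E : finType) (G : multigraph V E) (L : {set {set E}})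
    (HL : linear_class G L) (Hnt : ~ trivial_class G L) (I : {set option E}) :
  I \in indep (J0 G L) <->
    (exists F : {set E}, forest G F /\ I = lift_edges F) \/
    (exists F : {set E},
       [/\ forest G F, ~ cobalanced G L (components G F) & I = add_e0 F]).
Proof. by rewrite (J0_indepE HL); apply: J0_indepP. Qed.
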